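(* Let $\eta_t(\omega)$ be the random walk in random environment built from $\delta\in(0,1/2)$, $\alpha>0$ and the i.i.d. vectors $(\xi_i,Y_i)$ as described in the context. Suppose $\mathbb{E}[\zeta_1]=0$, $s^2\in(0,\infty)$, $\lambda>0$, $\sigma^2\in[0,\infty)$ and $\alpha\in(0,1/2)$. Then, for $\mathbb{P}$-a.e. $\omega$, the stationary distribution $(\pi_n)_{n\in\mathbb{Z}^+}$ of the Markov chain $\eta_t(\omega)$ satisfies, as $n\to\infty$, $$\pi_n=\exp\left(-\left(\frac{\lambda}{1-\alpha}\right)n^{1-\alpha}[1+o(1)]\right).$$
   Context: Environment. Fix $\delta\in(0,1/2)$ and $\alpha>0$. Let $(\xi_i,Y_i)$, $i\in\mathbb{N}=\{1,2,\dots\}$, be i.i.d. random vectors on a probability space $(\Omega,\mathcal{F},\mathbb{P})$ (with expectation $\mathbb{E}$ and variance $\mathrm{Var}$) such that $\mathbb{P}[\delta\le\xi_1\le 1-\delta]=1$ and $Y_1$ takes values in $[-1,1]$; $\xi_1$ and $Y_1$ may be dependent. Set $p_0=q_0=1/2$ and, for $n\ge1$, let $p_n$ be the truncation of $\xi_n+Y_nn^{-\alpha}$ to $[\delta/2,1-\delta/2]$, i.e. $p_n=\xi_n+Y_nn^{-\alpha}$ if this lies in $[\delta/2,1-\delta/2]$, $p_n=\delta/2$ if $\xi_n+Y_nn^{-\alpha}<\delta/2$, and $p_n=1-\delta/2$ if $\xi_n+Y_nn^{-\alpha}>1-\delta/2$; let $q_n=1-p_n$. The environment is $\omega=(p_0,p_1,p_2,\dots)$.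 Walk. Given $\omega$, $(\eta_t(\omega);t\in\mathbb{Z}^+)$, $\mathbb{Z}^+=\{0,1,2,\dots\}$, is the irreducible aperiodic Markov chain on $\mathbb{Z}^+$ with transition probabilities: from $n\ge1$, to $n-1$ with probability $p_n$ and to $n+1$ with probability $q_n$; from $0$, to $0$ with probability $p_0$ and to $1$ with probability $q_0$. It is known that under the hypotheses of the claim this chain is ergodic (positive recurrent) for $\mathbb{P}$-a.e. $\omega$, so it has a unique stationary distribution $(\pi_n)_{n\in\mathbb{Z}^+}$ (depending on $\omega$). Notation. $\zeta_n=\log\left(\frac{\xi_n}{1-\xi_n}\right)$, $Z_n=\frac{Y_n}{\xi_n(1-\xi_n)}$, $\lambda=\mathbb{E}[Z_1]$, $s^2=\mathrm{Var}[\xi_1]$, $\sigma^2=\mathrm{Var}[Y_1]$. *)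

(* Defs.v *)
From HB Require Import structures.
From mathcomp Require Import all_boot all_order all_algebra finmap.
From mathcomp Require Import all_classical all_reals all_analysis.

Set Implicit Arguments.
Unset Strict Implicit.
Unset Printing Implicit Defensive.

Import Order.TTheory GRing.Theory Num.Theory.
Import numFieldNormedType.Exports.

Local Open Scope classical_set_scope.
Local Open Scope ring_scope.

Section Iid.
Context {d d' : measure_display} {T : measurableType d} {V : measurableType d'}
  {R : realType} {I : choiceType}.
Variables (P : probability T R) (D : set I) (X : I -> T -> V).

Definition identically_distributed :=
  forall i j, D i -> D j -> forall B : set V, measurable B ->
    P (X i @^-1` B) = P (X j @^-1` B).

Definition mutually_independent :=
  forall J : {fset I}, [set` J] `<=` D ->
  forall B : I -> set V, (forall i, measurable (B i)) ->
    P (\bigcap_(i in [set` J]) (X i @^-1` B i)) =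
    (\prod_(i <- J) P (X i @^-1` B i))%E.

Definition iid := mutually_independent /\ identically_distributed.
End Iid.

Section Environment.
Context {R : realType} {T : Type}.
Implicit Types (delta alpha : R) (xi Y : nat -> T -> R).

Definition truncate (a b x : R) : R := Num.max a (Num.min x b).

(* The sequences xi and Y are indexed from 1: xi 0 and Y 0 are never used. *)
Definition environment delta alpha xi Y (w : T) (n : nat) : R :=
  if n == 0%N then 2^-1
  else truncate (delta / 2) (1 - delta / 2)
         (xi n w + Y n w * n%:R `^ (- alpha)).

Definition zeta xi (n : nat) (w : T) : R := ln (xi n w / (1 - xi n w)).

Definition Zvar xi Y (n : nat) (w : T) : R :=
  Y n w / (xi n w * (1 - xi n w)).
End Environment.

Section Chain.
Context {R : realType}.
Implicit Types (p mu : nat -> R) (K : nat -> nat -> R).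

(* Transition probability from [i] to [j]; since [0.-1 = 0], a downward step
   from state 0 is the holding step. *)
Definition walk_trans p (i j : nat) : R :=
  if j == i.-1 then p i else if j == i.+1 then 1 - p i else 0.

Definition stationary_distribution K mu :=
  [/\ forall i, 0 <= mu i,
      series mu @ \oo --> (1 : R)
    & forall j, series (fun i => mu i * K i j) @ \oo --> mu j].
End Chain.

(* Main.v *)
(* Detailed balance gives [pi_n = pi_0 (q_0 / q_n) prod_{k <= n} q_k / p_k], so
   up to a bounded term [- ln pi_n] is the sum of [logit p_k] over [1 <= k <= n].
   A second-order Taylor expansion yields
   [logit p_k = zeta_k + Z_k k^-alpha + O(k^(-2 alpha))], that is
   [W_k + lambda k^-alpha + O(k^(-2 alpha))] where the
   [W_k = zeta_k + (Z_k - lambda) k^-alpha] are independent, centered and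
   bounded. The deterministic part contributes
   [lambda n^(1 - alpha) / (1 - alpha) + O(n^(1 - 2 alpha))]. Chernoff's bound
   with [t] of order [n^(-1/2)] and the Borel-Cantelli lemma show that
   [W_1 + ... + W_n = o(n^b)] almost surely for every [b > 1/2], in particular
   for [b = 1 - alpha]. *)
From HB Require Import structures.
Require Import Defs.
From mathcomp Require Import all_boot all_order all_algebra finmap.
From mathcomp Require Import all_classical all_reals all_analysis.
From mathcomp Require Import measurable_realfun zify ring lra.

Import Order.TTheory GRing.Theory Num.Theory.
Import numFieldNormedType.Exports.

Local Open Scope classical_set_scope.
Local Open Scope ring_scope.

(** * Elementary estimates *)

Section RealAnalysis.
Context {R : realType}.
Implicit Types (x y h a c g : R) (n k : nat).

(** Inverting [1 - x <= expR (- x)] gives [expR x <= (1 - x)^-1], and [(1 + x + 2 * x ^+ 2) * (1 -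
    x) = 1 + x ^+ 2 * (1 - 2 * x)] is at least 1 in this range. *)
Lemma expR_le_quadratic x : x <= 2^-1 -> expR x <= 1 + x + 2 * x ^+ 2.
Proof.
move=> xle; have x1 : 0 < 1 - x by lra.
have H : 1 - x <= expR (- x) by exact: expR_ge1Dx.
rewrite -[x in expR x]opprK expRN.
have -> : 1 + x + 2 * x ^+ 2 = ((1 + x + 2 * x ^+ 2) * (1 - x)) / (1 - x).
  by rewrite mulfK// gt_eqF.
apply: (@le_trans _ _ (1 - x)^-1); first by rewrite lef_pV2// posrE ?expR_gt0.
rewrite ler_peMl ?invr_ge0 ?(ltW x1)//.
have H2 : 0 <= x ^+ 2 * (1 - 2 * x) by apply: mulr_ge0; [exact: sqr_ge0|lra].
suff -> : (1 + x + 2 * x ^+ 2) * (1 - x) = 1 + x ^+ 2 * (1 - 2 * x) by lra.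
ring.
Qed.

(** The exponential dominates its Taylor term of order [m.+1], where [m] is chosen with
    [g * m.+1%:R >= 2]. The terms are thus O(n^-2) and compare with a telescoping series. *)
Lemma cvg_series_expR_powR c g : 0 < c -> 0 < g ->
  cvgn (series (fun n => expR (- (c * n%:R `^ g)))).
Proof.
move=> c0 g0.
pose m := Num.Def.truncn (2 / g).
have mg : 2 <= g * m.+1%:R.
  by rewrite mulrC -ler_pdivrMr// ltW// truncnS_gt.
(* The summand 2 covers [n = 0], where the term is 1 and the telescoping increment 1/2. The factor 6
   comes from (y + 1)(y + 2) <= 6 y^2 for y >= 1. *)
pose K := 6 * (m.+1`!%:R / c ^+ m.+1) + 2.
have K2 : 2 <= K.
  by rewrite lerDr mulr_ge0// divr_ge0// exprn_ge0// ltW.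
apply: (@series_le_cvg _ _ (fun n => K * (n.+1%:R^-1 - n.+2%:R^-1))).
- by move=> n; exact: expR_ge0.
- move=> n; rewrite mulr_ge0 ?subr_ge0 ?lef_pV2 ?posrE ?ler_nat//.
  by rewrite (le_trans _ K2).
- move=> n.
  have -> : n.+1%:R^-1 - n.+2%:R^-1 = (n.+1%:R * n.+2%:R)^-1 :> R.
    have -> : n.+2%:R = n.+1%:R + 1 :> R by rewrite -natr1.
    field; have := ltr0Sn R n; have := ltr0Sn R n.+1.
    by rewrite -[n.+2%:R]natr1 => p1 p2; rewrite !gt_eqF.
  case: n => [|n].
    rewrite powR0 ?gt_eqF// mulr0 oppr0 expR0 mul1r.
    by rewrite ler_pdivlMr// mul1r.
  set x := c * _.
  have n0 : 0 < n.+1%:R `^ g :> R by rewrite powR_gt0.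
  have x0 : 0 < x by rewrite mulr_gt0.
  have Hx : x ^+ m.+1 / m.+1`!%:R <= expR x.
    by apply: le_trans (expR_ge1Dxn m (ltW x0)); rewrite lerDr.
  have Hn : n.+1%:R ^+ 2 <= (n.+1%:R `^ g) ^+ m.+1 :> R.
    rewrite -!powR_mulrn// ?powR_ge0// -powRrM.
    by rewrite ler_powR// ler1n.
  have fact0 : 0 < m.+1`!%:R :> R by rewrite ltr0n fact_gt0.
  have cm0 : 0 < c ^+ m.+1 by rewrite exprn_gt0.
  rewrite expRN ler_pdivlMr// mulrC.
  rewrite ler_pdivrMr ?expR_gt0//.
  apply: (@le_trans _ _ (K * (x ^+ m.+1 / m.+1`!%:R))); last first.
    by rewrite ler_wpM2l// (le_trans _ K2).
  apply: (@le_trans _ _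
    (6 * (m.+1`!%:R / c ^+ m.+1) * (x ^+ m.+1 / m.+1`!%:R))); last first.
    by rewrite ler_wpM2r ?lerDl// divr_ge0 ?exprn_ge0 ?ltW.
  rewrite exprMn.
  have -> : 6 * (m.+1`!%:R / c ^+ m.+1) *
        (c ^+ m.+1 * (n.+1%:R `^ g) ^+ m.+1 / m.+1`!%:R)
      = 6 * (n.+1%:R `^ g) ^+ m.+1.
    by field; rewrite !gt_eqF.
  apply: (@le_trans _ _ (6 * n.+1%:R ^+ 2)); last by rewrite ler_pM2l.
  have y1 : 1 <= n.+1%:R :> R by rewrite ler1n.
  rewrite -[n.+3%:R]natr1 -[n.+2%:R]natr1; move: y1.
  move: (n.+1%:R : R) => y y1.
  have : 0 <= (y - 1) * (5 * y + 2) by apply: mulr_ge0; lra.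
  by rewrite expr2; lra.
- apply: is_cvg_seriesZ; apply/cvg_ex; exists 1.
  have -> : series (fun n => n.+1%:R^-1 - n.+2%:R^-1) =
      (fun n => 1 - n.+1%:R^-1) :> (nat -> R).
    apply/funext => n; rewrite /series/=.
    elim: n => [|n IH]; first by rewrite big_geq// invr1 subrr.
    by rewrite big_nat_recr//= IH addrA subrK.
  rewrite -[X in _ --> X]subr0; apply: cvgB; first exact: cvg_cst.
  exact: cvg_harmonic.
Qed.

(** Bernoulli's inequality for exponents in [0, 1], by concavity of [ln] between [1 + x] and 1. The
    endpoint [x = -1] is separate because its logarithm is not meaningful. *)
Lemma powR1D_le g x : 0 <= g <= 1 -> -1 <= x -> (1 + x) `^ g <= 1 + g * x.
Proof.
move=> /andP[g0 g1]; rewrite le_eqVlt => /predU1P[<-|x1].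
  rewrite subrr; have [->|gn0] := eqVneq g 0; first by rewrite powRr0 mul0r addr0.
  by rewrite powR0// mulrN1 subr_ge0.
have y0 : 0 < 1 + x by lra.
have := @concave_ln R (Itv01 g0 g1) (1 + x) 1 y0 ltr01.
rewrite !convRE/= ln1 mulr0 addr0 mulr1.
have -> : g * (1 + x) + (1 - g) = 1 + g * x by ring.
rewrite /powR gt_eqF// => H.
have gx0 : 0 < 1 + g * x.
  move: g0; rewrite le_eqVlt => /predU1P[<-|g0]; first by rewrite mul0r addr0.
  have := mulr_gt0 g0 y0; lra.
by rewrite -[leRHS]lnK ?posrE// ler_expR.
Qed.

(* [k^(1-a)] is concave with derivative [(1-a) k^(-a)], so its increments
   before and after [k] bracket [(1-a) k^(-a)]. *)
Lemma powR_increments a k : 0 <= a <= 1 ->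
  k.+2%:R `^ (1 - a) - k.+1%:R `^ (1 - a) <= (1 - a) * k.+1%:R `^ (- a) /\
  (1 - a) * k.+1%:R `^ (- a) <= k.+1%:R `^ (1 - a) - k%:R `^ (1 - a) :> R.
Proof.
move=> /andP[a0 a1]; have b01 : 0 <= 1 - a <= 1 by lra.
have [y yE] : exists y : R, y = k.+1%:R by exists k.+1%:R.
have y0 : 0 < y by rewrite yE.
have y1 : y^-1 <= 1 by rewrite invf_le1// yE ler1n.
rewrite -yE.
have yV : 0 < y^-1 by rewrite invr_gt0.
have Ha : y `^ (- a) = y `^ (1 - a) * y^-1.
  rewrite -[in RHS](powR_inv1 (ltW y0)) -powRD; last by rewrite (gt_eqF y0) implybT.
  congr (_ `^ _); ring.
have yb : 0 < y `^ (1 - a) by rewrite powR_gt0.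
have lb1 : -1 <= y^-1 by rewrite (le_trans _ (ltW yV)).
have lb2 : -1 <= - y^-1 by rewrite lerN2.
split.
- have -> : k.+2%:R `^ (1 - a) = y `^ (1 - a) * (1 + y^-1) `^ (1 - a).
    rewrite -powRM ?addr_ge0 ?(ltW y0) ?(ltW yV)//; congr (_ `^ _).
    by rewrite mulrDr mulr1 divff ?gt_eqF// yE natr1.
  rewrite Ha.
  have := @powR1D_le (1 - a) (y^-1) b01 lb1.
  rewrite -(ler_pM2l yb); lra.
- have -> : k%:R `^ (1 - a) = y `^ (1 - a) * (1 + - y^-1) `^ (1 - a).
    rewrite -powRM ?subr_ge0 ?(ltW y0)//; congr (_ `^ _).
    by rewrite mulrBr mulr1 divff ?gt_eqF// yE -natr1 addrK.
  rewrite Ha.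
  have := @powR1D_le (1 - a) (- y^-1) b01 lb2.
  rewrite -(ler_pM2l yb); lra.
Qed.

(** Both bounds telescope [powR_increments]. The lower one naturally has [n.+1] in place of [n], and
    its [- 1] is the initial value 1^(1 - a). *)
Lemma sum_powRN_bounds a n : 0 <= a < 1 ->
  n%:R `^ (1 - a) - 1 <= (1 - a) * \sum_(1 <= k < n.+1) k%:R `^ (- a)
    <= n%:R `^ (1 - a).
Proof.
move=> /andP[a0 a1]; have a01 : 0 <= a <= 1 by lra.
apply/andP; split.
- apply: (@le_trans _ _ (n.+1%:R `^ (1 - a) - 1)).
    by rewrite lerB// ge0_ler_powR ?nnegrE ?ler_nat ?leqnSn//; lra.
  elim: n => [|n IH]; first by rewrite big_geq// powR1 subrr mulr0.
  rewrite big_nat_recr//= mulrDr.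
  have [H _] := powR_increments a n a01; lra.
- elim: n => [|n IH]; first by rewrite big_geq// mulr0 powR_ge0.
  rewrite big_nat_recr//= mulrDr.
  have [_ H] := powR_increments a n a01; lra.
Qed.

Lemma ln1D_bounds x : -1 < x -> 0 <= x - ln (1 + x) <= x ^+ 2 / (1 + x).
Proof.
move=> x1; have p : 0 < 1 + x by lra.
apply/andP; split; first by rewrite subr_ge0 le_ln1Dx.
have := @le_ln1Dx R ((1 + x)^-1 - 1); rewrite subrKC lnV ?posrE//.
have H : 0 < (1 + x)^-1 by rewrite invr_gt0.
move=> /(_ ltac:(lra)).
have -> : x ^+ 2 / (1 + x) = x - 1 + (1 + x)^-1 by field; rewrite gt_eqF//.
lra.
Qed.

Definition logit x := ln (x / (1 - x)).

(** The increment is ln (1 + h / x) - ln (1 - h / (1 - x)), whose linear parts add up to h / (x (1 -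
    x)). The two remainders are nonnegative and enter with opposite signs, so the larger one bounds
    the error. *)
Lemma logit_taylor2 (d : R) x h :
  0 < d -> d <= x <= 1 - d -> d <= x + h <= 1 - d ->
  `|logit (x + h) - logit x - h / (x * (1 - x))| <= h ^+ 2 / d ^+ 2.
Proof.
move=> d0 /andP[x0 x1] /andP[y0 y1].
have xp : 0 < x by lra.
have xq : 0 < 1 - x by lra.
have yp : 0 < x + h by lra.
have yq : 0 < 1 - (x + h) by lra.
have e1 : x + h = x * (1 + h / x) by field; rewrite gt_eqF//.
have e2 : 1 - (x + h) = (1 - x) * (1 + - h / (1 - x)) by field; rewrite gt_eqF//.
have p1 : 0 < 1 + h / x by rewrite -(pmulr_rgt0 _ xp) -e1.
have p2 : 0 < 1 + - h / (1 - x) by rewrite -(pmulr_rgt0 _ xq) -e2.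
have -> : logit (x + h) - logit x = ln (1 + h / x) - ln (1 + - h / (1 - x)).
  rewrite /logit !ln_div ?posrE// e2 e1 !lnM ?posrE//; ring.
have -> : h / (x * (1 - x)) = h / x - - h / (1 - x) by field; rewrite !gt_eqF.
have /andP[a1 b1] := @ln1D_bounds (h / x) ltac:(lra).
have /andP[a2 b2] := @ln1D_bounds (- h / (1 - x)) ltac:(lra).
have bnd z w : d <= z -> d <= w -> h ^+ 2 / (z * w) <= h ^+ 2 / d ^+ 2.
  move=> dz dw; rewrite ler_wpM2l ?sqr_ge0// lef_pV2 ?posrE ?mulr_gt0 ?exprn_gt0//;
    last 2 first.
  - lra.
  - lra.
  by rewrite expr2; nra.
have c1 : (h / x) ^+ 2 / (1 + h / x) <= h ^+ 2 / d ^+ 2.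
  have -> : (h / x) ^+ 2 / (1 + h / x) = h ^+ 2 / (x * (x + h)).
    by field; rewrite !gt_eqF.
  by apply: bnd.
have c2 : (- h / (1 - x)) ^+ 2 / (1 + - h / (1 - x)) <= h ^+ 2 / d ^+ 2.
  have -> : (- h / (1 - x)) ^+ 2 / (1 + - h / (1 - x)) =
      h ^+ 2 / ((1 - x) * (1 - (x + h))).
    by field; rewrite !gt_eqF//; lra.
  by apply: bnd; lra.
rewrite ler_norml; lra.
Qed.

End RealAnalysis.

(** * Limits of normalised power sums *)

Section PowerLimits.
Context {R : realType}.
Implicit Types (u : nat -> R) (a b : R).

Lemma cvg_natr_powRN b : 0 < b -> (fun n => n%:R `^ (- b)) @ \oo --> (0 : R).
Proof.
move=> b0; apply/cvgr0Pnorm_lt => e e0.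
pose x := e `^ (- b^-1).
exists (Num.truncn x).+1 => // n /= xn.
have x0 : 0 < x by rewrite powR_gt0.
have xn' : x < n%:R.
  by apply: (lt_le_trans (truncnS_gt x)); rewrite ler_nat.
rewrite ger0_norm ?powR_ge0// powRN.
have -> : e = (x `^ b)^-1.
  by rewrite -powRN -powRrM mulrNN mulVf ?gt_eqF// powRr1// ltW.
rewrite ltf_pV2 ?posrE ?powR_gt0 ?(lt_trans x0 xn')//.
by rewrite gt0_ltr_powR// ?nnegrE ?ltW// (lt_trans x0 xn').
Qed.

Lemma cvg_bounded_div_powR u M b : 0 < b -> (forall n, `|u n| <= M) ->
  (fun n => u n / n%:R `^ b) @ \oo --> (0 : R).
Proof.
move=> b0 uM.
apply: (@squeeze_cvgr _ _ _ _ (fun n => - (M * n%:R `^ (- b)))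
  (fun n => M * n%:R `^ (- b))).
- apply: nearW => n; rewrite -ler_norml powRN normrM normfV (ger0_norm (powR_ge0 _ _)).
  by rewrite ler_wpM2r// invr_ge0 powR_ge0.
- rewrite -oppr0; apply: cvgN; rewrite -[X in _ --> X](mulr0 M).
  by apply: cvgMl_tmp; exact: cvg_natr_powRN.
- rewrite -[X in _ --> X](mulr0 M).
  by apply: cvgMl_tmp; exact: cvg_natr_powRN.
Qed.

Lemma powRN_mul_powR (n : nat) b : (0 < n)%N -> n%:R `^ (- b) * n%:R `^ b = 1 :> R.
Proof. by move=> n0; rewrite powRN mulVf// gt_eqF// powR_gt0// ltr0n. Qed.

Lemma cvg_sum_powRN a : 0 <= a < 1 ->
  (fun n => (\sum_(1 <= k < n.+1) k%:R `^ (- a)) / n%:R `^ (1 - a)) @ \oo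
    --> ((1 - a)^-1 : R).
Proof.
move=> a01; have /andP[a0 a1] := a01; have b0 : 0 < 1 - a by rewrite subr_gt0.
apply: (@squeeze_cvgr _ _ _ _ (fun n => (1 - a)^-1 * (1 - n%:R `^ (- (1 - a))))
   (fun=> (1 - a)^-1)).
- exists 1%N => // n /= n1.
  have /andP[H1 H2] := sum_powRN_bounds a n a01.
  have pn : 0 < n%:R `^ (1 - a) :> R by rewrite powR_gt0 ?ltr0n.
  have E := powRN_mul_powR n (1 - a) n1.
  rewrite !ler_pdivlMr// ler_pdivrMr// -mulrA mulrBl E mul1r.
  by rewrite !(mulrC (1 - a)^-1) ler_pdivrMr// ler_pdivlMr// !(mulrC _ (1 - a)) H1 H2.
- rewrite -[X in _ --> X]mulr1; apply: cvgMl_tmp.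
  rewrite -[X in _ --> X](subr0 1); apply: cvgB; first exact: cvg_cst.
  exact: cvg_natr_powRN.
- exact: cvg_cst.
Qed.

End PowerLimits.

(** * Log-odds of the truncated environment *)

Section Deterministic.
Context {R : realType}.

Lemma truncate_bounds (a b x : R) : a <= b -> a <= truncate a b x <= b.
Proof. by move=> ab; rewrite /truncate le_max lexx/= ge_max ab ge_min lexx orbT. Qed.

Lemma truncate_id (a b x : R) : a <= x <= b -> truncate a b x = x.
Proof. by move=> /andP[ax xb]; rewrite /truncate min_l// max_r. Qed.

(* The truncation is inactive when [|y| <= delta / 2]; otherwise [|y|] itself
   is at most [(2 / delta) * y ^+ 2]. *)
Lemma truncateD_error (delta x y : R) : 0 < delta -> delta < 1 / 2 ->
  delta <= x <= 1 - delta ->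
  let h := truncate (delta / 2) (1 - delta / 2) (x + y) - x in
  h ^+ 2 <= y ^+ 2 /\ `|h - y| <= 2 / delta * y ^+ 2.
Proof.
move=> d0 d2 /andP[x1 x2] h.
(* As [x] stays at distance at least [delta / 2] from both truncation levels, clipping shortens the
   displacement [y] without changing its sign. Hence |h| <= |y| and |h - y| <= |y|. *)
have hE : [\/ h = y, (h = delta / 2 - x /\ y < delta / 2 - x)
     | h = 1 - delta / 2 - x /\ 1 - delta / 2 - x < y].
  rewrite /h /truncate; case: (leP (x + y) (1 - delta / 2)) => H1;
  case: (leP (delta / 2) _) => H2.
  - by constructor 1; ring.
  - by constructor 2; split=> //; lra.
  - by constructor 3; split=> //; lra.
  - by exfalso; lra.
case: hE => [->|[-> yl]|[-> yl]].
- split=> //; rewrite subrr normr0 mulr_ge0 ?sqr_ge0// divr_ge0 ?ltW//.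
- split; first by rewrite !expr2; nra.
  rewrite ger0_norm; last lra.
  apply: (@le_trans _ _ (- y)); first lra.
  rewrite mulrAC ler_pdivlMr// expr2; nra.
- split; first by rewrite !expr2; nra.
  rewrite ler0_norm; last lra.
  apply: (@le_trans _ _ y); first lra.
  rewrite mulrAC ler_pdivlMr// expr2; nra.
Qed.

(** Taylor's formula is applied to the true displacement [z - x] with margin [delta / 2], which
    gives the constant 4 / delta^2. Replacing [z - x] by [y] in the linear term costs 2 / delta,
    divided by x (1 - x) >= delta^2. *)
Lemma logit_truncateD (delta x y : R) : 0 < delta -> delta < 1 / 2 ->
  delta <= x <= 1 - delta ->
  `|logit (truncate (delta / 2) (1 - delta / 2) (x + y)) - logit x
    - y / (x * (1 - x))|
  <= (4 / delta ^+ 2 + 2 / delta ^+ 3) * y ^+ 2.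
Proof.
move=> d0 d2 xd; have /andP[x1 x2] := xd.
have [] := truncateD_error delta x y d0 d2 xd.
have ab : delta / 2 <= 1 - delta / 2 by lra.
have := truncate_bounds _ _ (x + y) ab.
set z := truncate _ _ _ => zb hy hyy.
have Lt := @logit_taylor2 R (delta / 2) x (z - x).
have {Lt}/Lt : 0 < delta / 2 by rewrite divr_gt0.
rewrite subrKC => /(_ ltac:(lra) zb) Lt.
have xx0 : delta ^+ 2 <= x * (1 - x) by rewrite expr2; nra.
have dd0 : 0 < delta ^+ 2 by rewrite exprn_gt0.
have xx : 0 < x * (1 - x) by exact: lt_le_trans xx0.
have -> : logit z - logit x - y / (x * (1 - x)) =
  (logit z - logit x - (z - x) / (x * (1 - x))) +
  (z - x - y) / (x * (1 - x)) by ring.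
apply: (le_trans (ler_normD _ _)); rewrite [leRHS]mulrDl; apply: lerD.
  apply: (le_trans Lt).
  have -> : (z - x) ^+ 2 / (delta / 2) ^+ 2 = 4 / delta ^+ 2 * (z - x) ^+ 2.
    by field; rewrite gt_eqF.
  by rewrite ler_wpM2l// divr_ge0// ltW.
rewrite normrM normfV (gtr0_norm xx).
apply: (@le_trans _ _ (2 / delta * y ^+ 2 / delta ^+ 2)); last first.
  rewrite le_eqVlt; apply/orP; left; apply/eqP; field; rewrite gt_eqF//.
apply: ler_pM => //; first by rewrite invr_ge0 ltW.
by rewrite lef_pV2 ?posrE.
Qed.

Lemma cvg_sum_logit (delta alpha lam : R) (x y p : nat -> R) :
  0 < delta -> delta < 1 / 2 -> 0 < alpha -> alpha < 1 / 2 ->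
  (forall k, (1 <= k)%N -> delta <= x k <= 1 - delta) ->
  (forall k, (1 <= k)%N -> -1 <= y k <= 1) ->
  (forall k, (1 <= k)%N -> p k =
     truncate (delta / 2) (1 - delta / 2) (x k + y k * k%:R `^ (- alpha))) ->
  (fun n => (\sum_(1 <= k < n.+1) (logit (x k) +
      (y k / (x k * (1 - x k)) - lam) * k%:R `^ (- alpha))) / n%:R `^ (1 - alpha))
    @ \oo --> (0 : R) ->
  (fun n => (\sum_(1 <= k < n.+1) logit (p k)) / n%:R `^ (1 - alpha)) @ \oo
    --> lam / (1 - alpha).
Proof.
move=> d0 d2 a0 a2 xd y1 pE S0.
pose K := 4 / delta ^+ 2 + 2 / delta ^+ 3.
have K0 : 0 <= K by rewrite addr_ge0// divr_ge0 ?exprn_ge0 ?ltW.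
pose W k := logit (x k) + (y k / (x k * (1 - x k)) - lam) * k%:R `^ (- alpha).
pose r k := logit (p k) - W k - lam * k%:R `^ (- alpha).
have rK k : (1 <= k)%N -> `|r k| <= K * k%:R `^ (- (2 * alpha)).
  move=> k1; rewrite /r /W (pE k k1).
  have := logit_truncateD delta (x k) (y k * k%:R `^ (- alpha)) d0 d2 (xd k k1).
  set z := truncate _ _ _; set q := k%:R `^ (- alpha) => H.
  have -> : logit z - (logit (x k) + (y k / (x k * (1 - x k)) - lam) * q)
      - lam * q =
     logit z - logit (x k) - y k * q / (x k * (1 - x k)) by ring.
  apply: (le_trans H); rewrite -/K ler_wpM2l//.
  have -> : k%:R `^ (- (2 * alpha)) = q ^+ 2.
    by rewrite -powR_mulrn ?powR_ge0// -powRrM; congr (_ `^ _); ring.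
  rewrite exprMn ler_piMl ?sqr_ge0//.
  by have /andP[] := y1 k k1; rewrite expr2; nra.
have -> : (fun n => (\sum_(1 <= k < n.+1) logit (p k)) / n%:R `^ (1 - alpha)) =
  (fun n => (\sum_(1 <= k < n.+1) W k) / n%:R `^ (1 - alpha) +
    (lam * ((\sum_(1 <= k < n.+1) k%:R `^ (- alpha)) / n%:R `^ (1 - alpha)) +
    (\sum_(1 <= k < n.+1) r k) / n%:R `^ (1 - alpha))).
  apply/funext => n; rewrite mulrA -!mulrDl; congr (_ / _).
  by rewrite mulr_sumr -!big_split/=; apply: eq_bigr => k _; rewrite /r; ring.
rewrite -[X in _ --> X]add0r; apply: cvgD => //.
rewrite -[X in _ --> X]addr0; apply: cvgD.
  by apply: cvgMl_tmp; apply: cvg_sum_powRN; lra.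
(* With [2 * alpha < 1], the remainders sum to O(n^(1 - 2 alpha)) by [sum_powRN_bounds]. *)
have a2' : 0 <= 2 * alpha < 1 by lra.
pose K' := K / (1 - 2 * alpha).
apply: (@squeeze_cvgr _ _ _ _ (fun n => - (K' * n%:R `^ (- alpha)))
  (fun n => K' * n%:R `^ (- alpha))).
- exists 1%N => // n /= n1; rewrite -ler_norml.
  have pn : 0 < n%:R `^ (1 - alpha) :> R by rewrite powR_gt0 ?ltr0n.
  rewrite normrM normfV (gtr0_norm pn) ler_pdivrMr//.
  have -> : K' * n%:R `^ (- alpha) * n%:R `^ (1 - alpha) =
      K' * n%:R `^ (1 - 2 * alpha).
    rewrite -mulrA -powRD; last by rewrite pnatr_eq0 -lt0n n1 implybT.
    by congr (_ * _ `^ _); ring.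
  apply: (le_trans (ler_norm_sum _ _ _)).
  apply: (@le_trans _ _ (\sum_(1 <= k < n.+1) K * k%:R `^ (- (2 * alpha)))).
    by rewrite !big_nat; apply: ler_sum => k /andP[k1 _]; exact: rK.
  rewrite -mulr_sumr /K' -mulrA ler_wpM2l// ler_pdivlMl; last lra.
  by have /andP[] := sum_powRN_bounds (2 * alpha) n a2'.
- rewrite -oppr0; apply: cvgN; rewrite -[X in _ --> X](mulr0 K').
  by apply: cvgMl_tmp; exact: cvg_natr_powRN.
- rewrite -[X in _ --> X](mulr0 K').
  by apply: cvgMl_tmp; exact: cvg_natr_powRN.
Qed.

End Deterministic.

(** * Nearest-neighbour walks *)

Section NearestNeighbourWalk.
Context {R : realType} (p : nat -> R).
Implicit Types (nu : nat -> R).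
Hypothesis p01 : forall n, 0 < p n < 1.

Let p_gt0 n : 0 < p n. Proof. by have /andP[] := p01 n. Qed.
Let q_gt0 n : 0 < 1 - p n. Proof. by rewrite subr_gt0; have /andP[] := p01 n. Qed.

Definition inflow nu j :=
  (if j is i.+1 then nu i * (1 - p i) else nu 0%N * p 0%N) + nu j.+1 * p j.+1.

Lemma walk_trans_far i j : (j.+1 < i)%N || (i.+1 < j)%N -> walk_trans p i j = 0.
Proof. by move=> ij; rewrite /walk_trans !ifN//; lia. Qed.

Lemma cvg_inflow nu j :
  series (fun i => nu i * walk_trans p i j) @ \oo --> inflow nu j.
Proof.
apply: cvg_near_cst; exists j.+2 => // n /= jn.
have tail m : \sum_(j.+2 <= i < m) nu i * walk_trans p i j = 0.
  rewrite big_nat big1// => i /andP[ji _].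
  by rewrite walk_trans_far ?mulr0// ji.
rewrite /series /= /inflow; case: j => [|j] in jn tail *.
  rewrite big_ltn ?(leq_trans _ jn)// big_ltn// tail addr0.
  by rewrite /walk_trans.
have j_le_n : (j <= n)%N by lia.
rewrite (big_cat_nat (leq0n j) j_le_n) /=.
rewrite big_nat big1 ?add0r; last first.
  by move=> i /andP[_ ij]; rewrite walk_trans_far ?mulr0// ltnS ij orbT.
rewrite big_ltn; last by lia.
rewrite big_ltn; last by lia.
rewrite big_ltn// tail addr0 /walk_trans.
have -> : (j.+1 == j.-1) = false by lia.
have -> : (j.+1 == j.+1.-1) = false by rewrite /=; lia.
have -> : (j.+1 == j.+2) = false by lia.
by rewrite /= !eqxx mulr0 add0r.
Qed.

(** The solution of detailed balance normalised to 1 at the origin. *)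
Definition balance_weight (n : nat) := \prod_(0 <= k < n) ((1 - p k) / p k.+1).

Lemma balance_weight_gt0 n : 0 < balance_weight n.
Proof. by apply: prodr_gt0 => k _; rewrite divr_gt0. Qed.

Lemma balance_weightS n :
  balance_weight n.+1 * p n.+1 = balance_weight n * (1 - p n).
Proof. by rewrite /balance_weight big_nat_recr//= mulrA divfK// gt_eqF. Qed.

Lemma inflow_balance_weight j : inflow balance_weight j = balance_weight j.
Proof.
rewrite /inflow balance_weightS; case: j => [|j] /=.
  by rewrite -mulrDr subrKC mulr1.
by rewrite -(balance_weightS j) -mulrDr subrKC mulr1.
Qed.

(** The net flux across the edge between [n] and [n.+1] vanishes by induction, since nothing flows
    to the left of 0. Stationarity thus forces detailed balance. *)
Lemma inflow_fixpoint nu : (forall j, inflow nu j = nu j) ->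
  forall n, nu n = nu 0%N * balance_weight n.
Proof.
move=> fix_nu.
have flux n : nu n.+1 * p n.+1 = nu n * (1 - p n).
  elim: n => [|n IH]; first by have := fix_nu 0%N; rewrite /inflow; lra.
  by have := fix_nu n.+1; rewrite /inflow -IH; lra.
elim=> [|n IH]; first by rewrite /balance_weight big_geq// mulr1.
apply: (@mulIf _ (p n.+1)); first by rewrite gt_eqF.
by rewrite flux IH -!mulrA balance_weightS.
Qed.

(** Existence is reversibility. For uniqueness, [inflow_fixpoint] makes any stationary [nu] a
    multiple of the weights, and total mass 1 fixes the factor. *)
Lemma stationary_balance : cvgn (series balance_weight) ->
  let Z : R := limn (series balance_weight) in
  [/\ 0 < Z, stationary_distribution (walk_trans p) (fun n => balance_weight n / Z)
    & forall nu, stationary_distribution (walk_trans p) nu ->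
        nu = (fun n => balance_weight n / Z)].
Proof.
move=> cvw Z.
have Z0 : 0 < Z.
  apply: (@lt_le_trans _ _ (series balance_weight 1)).
    by rewrite /series /= big_nat1 balance_weight_gt0.
  apply: nondecreasing_cvgn_le => //; apply: nondecreasing_series => n _ _.
  exact/ltW/balance_weight_gt0.
have Zn0 : Z != 0 by rewrite gt_eqF.
split=> //.
- split.
  + by move=> n; rewrite divr_ge0 ?ltW ?balance_weight_gt0.
  + rewrite -(divff Zn0).
    have -> : series (fun n => balance_weight n / Z) =
        (fun n => series balance_weight n / Z).
      by apply/funext => n; rewrite /series /= mulr_suml.
    exact: cvgMr_tmp.
  + move=> j; have := cvg_inflow (fun n => balance_weight n / Z) j.
    suff -> : inflow (fun n => balance_weight n / Z) j = balance_weight j / Z by [].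
    rewrite -[in RHS]inflow_balance_weight /inflow; case: j => [|j]; ring.
- move=> nu [_ nu1 nuK].
  have /inflow_fixpoint nuE : forall j, inflow nu j = nu j.
    by move=> j; apply: cvg_unique (cvg_inflow nu j) (nuK j).
  have nuZ : series nu @ \oo --> nu 0%N * Z.
    have -> : series nu = (fun n => nu 0%N * series balance_weight n).
      apply/funext => n; rewrite /series /= mulr_sumr; apply: eq_bigr => k _.
      exact: nuE.
    exact: cvgMl_tmp.
  have nu0 : nu 0%N * Z = 1 by apply: cvg_unique nuZ nu1.
  apply/funext => n; rewrite nuE mulrC; congr (_ * _).
  by apply: (@mulIf _ Z); rewrite ?gt_eqF// nu0 mulVf// gt_eqF.
Qed.

(** The product pairs [1 - p k] with [p k.+1]; regrouping factors of equal index gives the log-odds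
    and leaves two boundary terms. *)
Lemma ln_balance_weight n :
  - ln (balance_weight n) =
  \sum_(1 <= k < n.+1) logit (p k) + (ln (1 - p n) - ln (1 - p 0%N)).
Proof.
elim: n => [|n IH].
  by rewrite /balance_weight !big_geq// ln1 oppr0 subrr addr0.
rewrite big_nat_recr//= /balance_weight big_nat_recr//= lnM ?posrE ?divr_gt0//;
  last first.
  exact: balance_weight_gt0.
rewrite opprD IH /logit !ln_div ?posrE//; ring.
Qed.

(** The logarithm of the weights is -kappa n^b (1 + o(1)), the boundary terms being bounded thanks
    to [lo]. This yields summability by comparison with exp (- kappa n^b / 2), and the normalisation
    [ln Z] is absorbed by the error. *)
Lemma stationary_asymptotics (lo kappa b : R) : 0 < b -> 0 < kappa -> 0 < lo ->
  (forall n, p n <= 1 - lo) ->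
  (fun n => (\sum_(1 <= k < n.+1) logit (p k)) / n%:R `^ b) @ \oo --> kappa ->
  exists mu : nat -> R,
    [/\ stationary_distribution (walk_trans p) mu,
        forall nu, stationary_distribution (walk_trans p) nu -> nu = mu
      & exists2 eps : nat -> R, eps @ \oo --> (0 : R) &
          \forall n \near \oo, mu n = expR (- kappa * n%:R `^ b * (1 + eps n))].
Proof.
move=> b0 k0 lo0 plo Lk; have kn0 : kappa != 0 by rewrite gt_eqF.
(* The free constant serves twice: 0 for summability, [ln Z] for the final asymptotics. *)
have cvln c : (fun n => (- ln (balance_weight n) + c) / n%:R `^ b) @ \oo --> kappa.
  have -> : (fun n => (- ln (balance_weight n) + c) / n%:R `^ b) =
    (fun n => (\sum_(1 <= k < n.+1) logit (p k)) / n%:R `^ b +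
              (ln (1 - p n) - ln (1 - p 0%N) + c) / n%:R `^ b).
    by apply/funext => n; rewrite ln_balance_weight -mulrDl -addrA.
  rewrite -[X in _ --> X]addr0; apply: cvgD => //.
  apply: (@cvg_bounded_div_powR _ _ (- ln lo + `|- ln (1 - p 0%N) + c|)) => // n.
  rewrite -addrA (le_trans (ler_normD _ _))// lerD2r.
  rewrite ler0_norm ?lerN2; last by rewrite ln_le0// gerBl ltW.
  by rewrite ler_ln ?posrE//; have := plo n; lra.
pose e n := expR (- (kappa / 2 * n%:R `^ b)).
have ce : cvgn (series e) by apply: cvg_series_expR_powR => //; rewrite divr_gt0.
have cvw : cvgn (series balance_weight).
  have : \forall n \near \oo, kappa / 2 < (- ln (balance_weight n) + 0) / n%:R `^ b.
    apply: (cvgr_gt kappa); first exact: cvln.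
    by rewrite ltr_pdivrMr// ltr_pMr// ltr1n.
  move=> [N _ HN].
  (* The sum in [K] absorbs the indices below [N], where the exponential bound may fail. *)
  pose K := 1 + \sum_(0 <= k < N) balance_weight k / e k.
  have terms_ge0 k : 0 <= balance_weight k / e k.
    by rewrite divr_ge0 ?expR_ge0// ltW// balance_weight_gt0.
  have K1 : 1 <= K by rewrite lerDl sumr_ge0.
  apply: (@series_le_cvg _ _ (fun n => K * e n)).
  - by move=> n; rewrite ltW// balance_weight_gt0.
  - by move=> n; rewrite mulr_ge0 ?expR_ge0// (le_trans _ K1).
  - move=> n; have [Nn|nN] := leqP N n.
      apply: (@le_trans _ _ (e n)); last by rewrite ler_peMl ?expR_ge0.
      have := HN n Nn; rewrite addr0.
      (* At index 0 the quotient is 0, which contradicts [HN]; so this case cannot occur beyond the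
         threshold. *)
      have [->|n0] := posnP n.
        rewrite /balance_weight big_geq// ln1 oppr0 mul0r => H; exfalso; lra.
      rewrite ltr_pdivlMr ?powR_gt0 ?ltr0n// => H.
      rewrite -[leLHS]lnK ?posrE ?balance_weight_gt0// ler_expR; lra.
    rewrite -ler_pdivrMr ?expR_gt0//.
    apply: (@le_trans _ _ (\sum_(0 <= k < N) balance_weight k / e k)); last first.
      by rewrite lerDr.
    rewrite (bigD1_seq n) ?iota_uniq ?mem_index_iota//= lerDl.
    by rewrite sumr_ge0.
  - exact: is_cvg_seriesZ.
have [Z0 statmu uniqmu] := stationary_balance cvw.
set Z := limn _ in Z0 statmu uniqmu.
exists (fun n => balance_weight n / Z); split => //.
(* This error term solves the claimed identity exactly for every [n >= 1]. *)
exists (fun n => (- ln (balance_weight n) + ln Z) / n%:R `^ b / kappa - 1).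
  rewrite -(subrr 1) -[X in _ --> X - _](divff kn0).
  apply: cvgB; last exact: cvg_cst.
  by apply: cvgMr_tmp.
exists 1%N => // n /= n1.
rewrite subrKC; set y := n%:R `^ b.
have y0 : 0 < y by rewrite powR_gt0 ?ltr0n.
have -> : - kappa * y * ((- ln (balance_weight n) + ln Z) / y / kappa) =
   ln (balance_weight n) - ln Z by field; rewrite !gt_eqF.
by rewrite expRB !lnK ?posrE// balance_weight_gt0.
Qed.

End NearestNeighbourWalk.

(** * Integrals and independence *)

Section MeasurableReal.
Context {d : measure_display} {T : measurableType d} {R : realType}.

(** Writing 1/f as f times the real power (f^2)^(-1) reduces the claim to measurability of [powR];
    at zeros of [f] both sides are 0. *)
Lemma measurable_funV (f : T -> R) : measurable_fun setT f ->
  measurable_fun setT (fun w => (f w)^-1).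
Proof.
move=> mf.
have -> : (fun w => (f w)^-1) = (fun w => f w * (f w ^+ 2) `^ (- 1)).
  apply/funext => w; rewrite powR_inv1 ?sqr_ge0//.
  have [->|f0] := eqVneq (f w) 0; first by rewrite invr0 mul0r.
  by rewrite expr2 invfM mulrA divff// mul1r.
apply: measurable_funM => //.
apply: (measurableT_comp (g := fun w => f w ^+ 2) (measurable_powR (- 1))).
exact: measurable_funX.
Qed.

Lemma measurable_fun_div (f g : T -> R) : measurable_fun setT f ->
  measurable_fun setT g -> measurable_fun setT (fun w => f w / g w).
Proof. by move=> mf mg; apply: measurable_funM => //; exact: measurable_funV. Qed.

Lemma measurable_logit (f : T -> R) : measurable_fun setT f ->
  measurable_fun setT (fun w => logit (f w)).
Proof.
move=> mf; apply: (measurableT_comp (g := fun w => f w / (1 - f w)) (@measurable_ln R)).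
by apply: measurable_fun_div => //; exact: measurable_funB.
Qed.

Lemma measurable_truncate (a b : R) (f : T -> R) : measurable_fun setT f ->
  measurable_fun setT (fun w => truncate a b (f w)).
Proof.
move=> mf; apply: measurable_maxr => //; exact: measurable_minr.
Qed.

Lemma ae_of_probability1 (P : probability T R) (A : set T) :
  measurable A -> P A = 1%E -> {ae P, forall w, A w}.
Proof.
move=> mA PA; exists (~` A); split => //; first exact: measurableC.
by rewrite [LHS](probability_setC P mA) PA subee.
Qed.

Lemma integrable_bounded (P : probability T R) (f : T -> R) (C : R) :
  measurable_fun setT f -> (forall w, `|f w| <= C) ->
  P.-integrable setT (EFin \o f).
Proof.
move=> mf fC; apply: measurable_bounded_integrable => //.
  by rewrite (le_lt_trans (probability_le1 P measurableT))// ltry.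
exists C; split; first exact: num_real.
by move=> x Cx w _; apply: (le_trans (fC w)); exact: ltW.
Qed.

End MeasurableReal.

(** * Weighted integrals of functions of a random element *)

Section IntegralComp.
Context {d d' : measure_display} {T : measurableType d} {V : measurableType d'}
  {R : realType} (mu : {measure set T -> \bar R}) {X : T -> V}.
Hypothesis mX : measurable_fun setT X.
Local Open Scope ereal_scope.
Import HBNNSimple.

Lemma measurable_indic_comp (B : set V) : measurable B ->
  measurable_fun setT (fun w => (\1_B (X w))%:E : \bar R).
Proof.
move=> mB; apply/measurable_EFinP.
exact: (measurableT_comp (measurable_indic mB)).
Qed.

Lemma integral_nnsfun_comp_mul (G : T -> \bar R) (h : {nnsfun V >-> R}) :
  measurable_fun setT G -> (forall w, 0 <= G w) ->
  \int[mu]_w ((h (X w))%:E * G w) =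
  \sum_(y \in range h) (y%:E * \int[mu]_w ((\1_(h @^-1` [set y]) (X w))%:E * G w)).
Proof.
move=> mG G0.
transitivity (\int[mu]_w (\sum_(y \in range h)
    (y%:E * ((\1_(h @^-1` [set y]) (X w))%:E * G w)))).
  apply: eq_integral => w _; rewrite {1}fimfunE -fsumEFin// ge0_mule_fsuml.
    by apply: eq_fsbigr => y _; rewrite EFinM muleA.
  by move=> y; exact: nnfun_muleindic_ge0.
rewrite ge0_integral_fsum//.
- apply: eq_fsbigr => y /[!inE] -[v _ <-]; rewrite ge0_integralZl_EFin//.
  + by move=> w _; rewrite mule_ge0// lee_fin.
  + by apply: emeasurable_funM => //; apply: measurable_indic_comp.
- move=> y; apply: emeasurable_funM => //.
  by apply: emeasurable_funM => //; apply: measurable_indic_comp.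
- move=> y w _; rewrite muleA mule_ge0//.
  by rewrite -EFinM; exact: nnfun_muleindic_ge0.
Qed.

(** Equality of the weighted integrals passes from indicators to simple functions by linearity, then
    to nonnegative functions by monotone convergence. *)
Lemma eq_integral_comp_mul (G1 G2 : T -> \bar R) (f : V -> \bar R) :
  measurable_fun setT G1 -> (forall w, 0 <= G1 w) ->
  measurable_fun setT G2 -> (forall w, 0 <= G2 w) ->
  (forall B, measurable B -> \int[mu]_w ((\1_B (X w))%:E * G1 w) =
                             \int[mu]_w ((\1_B (X w))%:E * G2 w)) ->
  measurable_fun setT f -> (forall v, 0 <= f v) ->
  \int[mu]_w (f (X w) * G1 w) = \int[mu]_w (f (X w) * G2 w).
Proof.
move=> mG1 G10 mG2 G20 G12 mf f0.
pose f_ := nnsfun_approx measurableT mf.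
have lim G : measurable_fun setT G -> (forall w, 0 <= G w) ->
    \int[mu]_w (f (X w) * G w) =
    limn (fun n => \int[mu]_w ((f_ n (X w))%:E * G w)).
  move=> mG G0; rewrite -monotone_convergence//.
  - apply: eq_integral => w _; apply/esym/cvg_lim => //.
    rewrite (_ : (fun n => _) = (fun n => (EFin \o f_^~ (X w)) n * G w))//.
    have cf : EFin \o f_^~ (X w) @ \oo --> f (X w) by exact: cvg_nnsfun_approx.
    have nd : nondecreasing_seq (EFin \o f_^~ (X w)).
      by move=> m n mn; rewrite lee_fin; exact/lefP/nd_nnsfun_approx.
    (* Limits of products in the extended reals require excluding 0 times infinity. If either factor
       vanishes, all the approximating products vanish too, as the approximations lie below [f]. *)
    have [Gw0|Gw0] := eqVneq (G w) 0.
      by under eq_fun do rewrite Gw0 mule0; rewrite Gw0 mule0; exact: cvg_cst.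
    have [fw0|fw0] := eqVneq (f (X w)) 0.
      have f_0 n : (f_ n (X w))%:E = 0.
        apply/eqP; rewrite eq_le; apply/andP; split; last by rewrite lee_fin.
        rewrite -fw0 -(cvg_lim (@ereal_hausdorff R) cf).
        rewrite (cvg_lim (@ereal_hausdorff R) (ereal_nondecreasing_cvgn nd)).
        by apply: ereal_sup_ubound; exists n.
      by under eq_fun do rewrite /= f_0 mul0e; rewrite fw0 mul0e; exact: cvg_cst.
    apply: cvgeM => //; last exact: cvg_cst.
    by apply: neq0_mule_def; rewrite mule_eq0 negb_or fw0.
  - move=> n; apply: emeasurable_funM => //.
    by apply/measurable_EFinP; apply: measurableT_comp.
  - by move=> n w _; rewrite mule_ge0// lee_fin.
  - move=> w _ m n mn; rewrite lee_wpmul2r// lee_fin.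
    exact/lefP/nd_nnsfun_approx.
rewrite !lim//; congr (limn _); apply/funext => n.
rewrite !integral_nnsfun_comp_mul//; apply: eq_fsbigr => y _.
by rewrite G12.
Qed.

End IntegralComp.

Section Independence.
Context {d d' : measure_display} {T : measurableType d} {V : measurableType d'}
  {R : realType} {I : choiceType} (P : probability T R) (D : set I)
  (X : I -> T -> V).
Hypothesis mX : forall i, measurable_fun setT (X i).
Hypothesis indX : mutually_independent P D X.
Local Open Scope ereal_scope.

(* Independence factors indicators; one index at a time is upgraded from
   indicators of [X i] to an arbitrary nonnegative function of [X i]. *)
Lemma integral_prod_indic (f : I -> V -> \bar R) (s r : seq I) (B : I -> set V) :
  (forall i, measurable_fun setT (f i)) -> (forall i v, 0 <= f i v) ->
  (forall i, measurable (B i)) -> uniq (s ++ r) -> [set` s ++ r] `<=` D ->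
  \int[P]_w ((\prod_(i <- s) f i (X i w)) *
             (\1_(\bigcap_(i in [set` r]) (X i @^-1` B i)) w)%:E) =
  (\prod_(i <- s) \int[P]_w f i (X i w)) *
  \prod_(i <- r) P (X i @^-1` B i).
Proof.
move=> mf f0; elim: s r B => [|i s IH] r B mB.
  rewrite /= => ur rD.
  have mcap : measurable (\bigcap_(i in [set` r]) (X i @^-1` B i)).
    rewrite bigcap_seq; apply: bigsetI_measurable => i _.
    by rewrite -[_ @^-1` _]setTI; exact: mX.
  rewrite big_nil mul1e; under eq_integral do rewrite big_nil mul1e.
  rewrite integral_indic// setIT.
  have -> : [set` r] = [set` [fset x in r]%fset].
    by apply/seteqP; split => x /=; rewrite inE.
  have /indX/(_ B mB) E : [set` [fset x in r]%fset] `<=` D.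
    by move=> x /=; rewrite inE => xr; exact: rD.
  apply: (etrans E); apply: perm_big; apply: uniq_perm => //.
  by move=> x; rewrite inE.
rewrite cat_cons /= => /andP[isr usr] srD.
have iD : D i by apply: srD; rewrite /= inE eqxx.
pose A := \bigcap_(i in [set` r]) (X i @^-1` B i).
have mA : measurable A.
  rewrite /A bigcap_seq; apply: bigsetI_measurable => j _.
  by rewrite -[_ @^-1` _]setTI; exact: mX.
pose G w := (\prod_(i <- s) f i (X i w)) * (\1_A w)%:E.
pose c := (\prod_(i <- s) \int[P]_w f i (X i w)) * \prod_(i <- r) P (X i @^-1` B i).
have mG : measurable_fun setT G.
  apply: emeasurable_funM; last by apply/measurable_EFinP; exact: measurable_indic.
  rewrite /G; elim: (s) => [|j t IHt].
    by under eq_fun do rewrite big_nil; exact: measurable_cst.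
  under eq_fun do rewrite big_cons; apply: emeasurable_funM => //.
  exact: (measurableT_comp (mf j)).
have G0 w : 0 <= G w by rewrite mule_ge0// ?prode_ge0// lee_fin.
have c0 : 0 <= c.
  rewrite mule_ge0// prode_ge0// => j _; apply: integral_ge0 => w _; exact: f0.
transitivity (\int[P]_w (f i (X i w) * G w)).
  by apply: eq_integral => w _; rewrite big_cons muleA.
(* [G] may be replaced by the constant [c] once this is known against indicators of [X i]. That case
   is the induction hypothesis with [i] moved from the product into the intersection. *)
rewrite (eq_integral_comp_mul P (mX i) G (cst c))//.
- rewrite ge0_integralZr//; first by rewrite big_cons /c muleA.
  exact: (measurableT_comp (mf i)).
- move=> C mC.
  rewrite ge0_integralZr//; last exact: (measurable_indic_comp (mX i)).
  have -> : \int[P]_w (\1_C (X i w))%:E = P (X i @^-1` C).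
    rewrite -(setIT (X i @^-1` C)) -integral_indic//.
    by rewrite -[_ @^-1` _]setTI; exact: mX.
  (* Since [i] is not in [r], prescribing [C] at [i] leaves the other events unchanged. *)
  pose B' j := if j == i then C else B j.
  have mB' j : measurable (B' j) by rewrite /B'; case: ifP.
  have B'r j : j \in r -> B' j = B j.
    rewrite /B'; case: eqP => // -> ir; move: isr.
    by rewrite mem_cat ir orbT.
  have perm_sir : perm_eq (s ++ i :: r) (i :: s ++ r).
    by rewrite -cat1s perm_catCA.
  have capE : \bigcap_(j in [set` i :: r]) (X j @^-1` B' j) = X i @^-1` C `&` A.
    apply/seteqP; split => w.
      move=> H; split => [|j /= jr].
        by have := H i; rewrite /B' eqxx; apply; rewrite /= inE eqxx.
      by rewrite -B'r//; apply: H; rewrite /= inE jr orbT.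
    move=> [wC wA] j /=; rewrite inE => /predU1P[->|jr].
      by rewrite /B' eqxx.
    by rewrite B'r//; exact: wA.
  transitivity (\int[P]_w ((\prod_(i <- s) f i (X i w)) *
             (\1_(\bigcap_(j in [set` i :: r]) (X j @^-1` B' j)) w)%:E)).
    apply: eq_integral => w _; rewrite /G muleCA; congr (_ * _).
    by rewrite capE indicI EFinM.
  rewrite (IH (i :: r) B')//.
  + rewrite big_cons muleCA {1}/B' eqxx; congr (_ * (_ * _)).
    by rewrite !big_seq; apply: eq_bigr => j jr; rewrite B'r.
  + by rewrite (perm_uniq perm_sir) /= isr.
  + by move=> x; rewrite /= (perm_mem perm_sir); exact: srD.
Qed.

Lemma integral_prod_independent (f : I -> V -> \bar R) (s : seq I) :
  (forall i, measurable_fun setT (f i)) -> (forall i v, 0 <= f i v) ->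
  uniq s -> [set` s] `<=` D ->
  \int[P]_w (\prod_(i <- s) f i (X i w)) = \prod_(i <- s) \int[P]_w f i (X i w).
Proof.
move=> mf f0 us sD.
have := @integral_prod_indic f s [::] (fun=> setT) mf f0 (fun=> measurableT).
rewrite cats0 => /(_ us sD); rewrite big_nil mule1 => <-.
apply: eq_integral => w _.
by rewrite indicE mem_set ?mule1// => j.
Qed.

End Independence.

(** * Almost sure growth of bounded independent sums *)

Section AlmostSureRate.
Context {d : measure_display} {T : measurableType d} {R : realType}
  (P : probability T R) (W : nat -> T -> R) (C : R).
Hypothesis mW : forall k, measurable_fun setT (W k).
Hypothesis C_gt0 : 0 < C.
Hypothesis W_bounded : forall k w, `|W k w| <= C.
Hypothesis W_centered : forall k, (1 <= k)%N -> (\int[P]_w (W k w)%:E = 0)%E.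

Let S n w := \sum_(1 <= k < n.+1) W k w.

(** Independence enters this section only through the factorisation of exponential moments. *)
Hypothesis expR_sum_factor : forall t n,
  (\int[P]_w (expR (t * S n w))%:E =
   \prod_(1 <= k < n.+1) \int[P]_w (expR (t * W k w))%:E)%E.

Lemma measurable_sum_W n : measurable_fun setT (S n).
Proof. by apply: measurable_sum => k; exact: mW. Qed.

(** Integrating the quadratic bound kills the linear term by centering, and [1 + u <= expR u]
    restores an exponential, which multiplies well. *)
Lemma integral_expR_bounded k t : (1 <= k)%N -> `|t| * C <= 2^-1 ->
  (\int[P]_w (expR (t * W k w))%:E <= (expR (2 * (t * C) ^+ 2))%:E)%E.
Proof.
move=> k1 tC.
have iW : P.-integrable setT (EFin \o W k) by exact: (integrable_bounded P _ C).
have ic (c : R) : P.-integrable setT (EFin \o cst c).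
  by apply: finite_measure_integrable_cst.
have key w : expR (t * W k w) <= t * W k w + (1 + 2 * (t * C) ^+ 2).
  have tW : `|t * W k w| <= `|t| * C by rewrite normrM ler_wpM2l.
  have tW2 : t * W k w <= 2^-1.
    exact: le_trans (ler_norm _) (le_trans tW tC).
  have sq : (t * W k w) ^+ 2 <= (t * C) ^+ 2.
    rewrite -[leLHS]real_normK ?num_real// -[leRHS]real_normK ?num_real//.
    by rewrite lerXn2r ?nnegrE// (normrM t C) (gtr0_norm C_gt0).
  have := expR_le_quadratic _ tW2; lra.
apply: (@le_trans _ _
  (\int[P]_w (t%:E * (W k w)%:E + (1 + 2 * (t * C) ^+ 2)%:E))%E).
  apply: ge0_le_integral => //.
  - apply/measurable_EFinP; apply: measurableT_comp => //.
    by apply: measurable_funM.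
  - apply/measurable_EFinP; apply: measurable_funD => //.
    by apply: measurable_funM.
  - by move=> w _; rewrite -EFinM -EFinD lee_fin.
rewrite integralD//; last first.
- exact: ic.
- exact: integrableZl.
rewrite integralZl// W_centered// mule0 add0e integral_cst//.
rewrite (_ : _ setT = 1%E); last exact: probability_setT.
by rewrite mule1 lee_fin expR_ge1Dx.
Qed.

(** For this size of [t] the accumulated exponent [2 * (t * C) ^+ 2 * n%:R] is 1/2, so the bound is
    uniform in [n]. Prescribing only [|t|] covers both tails. *)
Lemma integral_expR_sum_le n t : `|t| = (2 * C)^-1 * n%:R `^ (- 2^-1) ->
  (\int[P]_w (expR (t * S n w))%:E <= (expR 1)%:E)%E.
Proof.
move=> tE; rewrite expR_sum_factor.
have [->|n0] := posnP n.
  by rewrite big_geq// lee_fin -[leLHS]expR0 ler_expR.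
have tC : `|t| * C <= 2^-1.
  have -> : `|t| * C = 2^-1 * n%:R `^ (- 2^-1) by rewrite tE; field; rewrite gt_eqF.
  rewrite ler_piMr// powRN invf_le1 ?powR_gt0 ?ltr0n//.
  by rewrite -[leLHS](powRr0 n%:R) ler_powR// ler1n.
have t2 : 2 * (t * C) ^+ 2 * n%:R = 2^-1.
  rewrite exprMn -[t ^+ 2]real_normK ?num_real// tE exprMn.
  have -> : (n%:R `^ (- 2^-1)) ^+ 2 = n%:R^-1 :> R.
    rewrite -powR_mulrn ?powR_ge0// -powRrM mulNr mulVf// powR_inv1//.
  by field; rewrite gt_eqF ?ltr0n//= gt_eqF.
have int0 k : (0 <= \int[P]_w (expR (t * W k w))%:E)%E.
  by apply: integral_ge0 => w _; rewrite lee_fin expR_ge0.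
have prod_le m : (\prod_(1 <= k < m.+1) \int[P]_w (expR (t * W k w))%:E <=
    (expR (2 * (t * C) ^+ 2 * m%:R))%:E)%E.
  elim: m => [|m IH]; first by rewrite big_geq// mulr0 expR0.
  rewrite big_nat_recr//= -[m.+1%:R]natr1 mulrDr mulr1 expRD EFinM lee_pmul ?prode_ge0//.
  exact: integral_expR_bounded.
by apply: (le_trans (prod_le n)); rewrite t2 lee_fin ler_expR; lra.
Qed.

(** Chernoff's bound: on the event, expR (- t a) (expR (t S) + expR (- t S)) is at least 1, one
    exponential for each tail. *)
Lemma probability_sum_ge n (a : R) :
  (P [set w | (a <= `|S n w|)%R] <=
   (2 * expR 1 * expR (- ((2 * C)^-1 * n%:R `^ (- 2^-1) * a)))%:E)%E.
Proof.
set t := (2 * C)^-1 * n%:R `^ (- 2^-1).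
have t0 : 0 <= t by rewrite mulr_ge0 ?powR_ge0// invr_ge0 mulr_ge0// ltW.
have mS := measurable_sum_W n.
have mA : measurable [set w | (a <= `|S n w|)%R].
  rewrite -[X in measurable X]setTI.
  apply: (measurable_fun_le (f := cst a) (g := fun w => `|S n w|)) => //.
  exact: measurableT_comp.
have mexp (u : R) : measurable_fun setT (fun w => (expR (u * S n w))%:E : \bar R).
  apply/measurable_EFinP; apply: measurableT_comp => //; exact: measurable_funM.
have exp0 (u : R) w : (0 <= (expR (u * S n w))%:E)%E by rewrite lee_fin expR_ge0.
apply: (@le_trans _ _ ((expR (- (t * a)))%:E *
    \int[P]_w ((expR (t * S n w))%:E + (expR (- t * S n w))%:E))%E); last first.
  rewrite ge0_integralD// EFinM [leRHS]muleC; apply: lee_wpmul2l.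
    by rewrite lee_fin expR_ge0.
  by rewrite mulr_natl mulr2n EFinD leeD// integral_expR_sum_le ?normrN ?ger0_norm.
rewrite -ge0_integralZl//; last 2 first.
- exact: emeasurable_funD.
- by move=> w _; rewrite adde_ge0.
rewrite -(setIT [set w | _]) -integral_indic//; apply: ge0_le_integral => //.
- by apply/measurable_EFinP; exact: measurable_indic.
- by apply: emeasurable_funM => //; exact: emeasurable_funD.
move=> w _; rewrite indicE -EFinD -EFinM lee_fin.
have [|] := boolP (w \in _); last by rewrite mulr_ge0 ?addr_ge0 ?expR_ge0.
rewrite inE /= => aS; rewrite expRN mulrC ler_pdivlMr ?expR_gt0// mul1r.
move: aS; rewrite ler_normr => /orP[aS|aS].
  by rewrite ler_wpDr ?expR_ge0// ler_expR ler_wpM2l.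
by rewrite ler_wpDl ?expR_ge0// ler_expR mulNr -mulrN ler_wpM2l.
Qed.

(** At level n^b / (m + 1) the tail bound is exponential in n^(b - 1/2), hence summable.
    Borel-Cantelli applies for each [m], and countably many null sets are discarded. *)
Lemma ae_sum_littleo_powR b : 2^-1 < b ->
  {ae P, forall w, (fun n => S n w / n%:R `^ b) @ \oo --> (0 : R)}.
Proof.
move=> b2.
pose F m n := [set w | (m.+1%:R^-1 * n%:R `^ b <= `|S n w|)%R].
have mF m n : measurable (F m n).
  rewrite -[X in measurable X]setTI.
  apply: (measurable_fun_le (f := cst _) (g := fun w => `|S n w|)) => //.
  by apply: measurableT_comp => //; exact: measurable_sum_W.
pose c m := (2 * C)^-1 * m.+1%:R^-1 : R.
have c0 m : 0 < c m by rewrite mulr_gt0 ?invr_gt0// mulr_gt0.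
have PF m n : (P (F m n) <= (2 * expR 1 * expR (- (c m * n%:R `^ (b - 2^-1))))%:E)%E.
  have [->|n0] := posnP n.
    rewrite powR0; last by rewrite subr_eq0 gt_eqF.
    rewrite mulr0 oppr0 expR0 mulr1 (le_trans (probability_le1 _ _))// lee_fin.
    by have := expR_ge1Dx (1 : R); lra.
  apply: (le_trans (probability_sum_ge _ _)).
  rewrite lee_fin ler_wpM2l ?mulr_ge0 ?expR_ge0//.
  rewrite ler_expR lerN2 le_eqVlt; apply/orP; left; apply/eqP.
  rewrite powRD; last by rewrite pnatr_eq0 -lt0n n0 implybT.
  by rewrite [RHS]mulrACA; congr (_ * _); rewrite mulrC.
have sumF m : (\sum_(n <oo) P (F m n) < +oo)%E.
  pose u n := 2 * expR 1 * expR (- (c m * n%:R `^ (b - 2^-1))).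
  have cv : cvgn (series u).
    apply: is_cvg_seriesZ; apply: cvg_series_expR_powR => //.
    by rewrite subr_gt0.
  apply: (@le_lt_trans _ _ (\sum_(n <oo) (u n)%:E)%E).
    by apply: lee_nneseries => // n _; exact: PF.
  rewrite (_ : limn _ = (limn (series u))%:E) ?ltry//.
  by rewrite -EFin_lim//; congr (limn _); apply/funext => n /=; rewrite sumEFin.
have PL0 m := lim_sup_set_cvg0 (mF m) (sumF m).
have : {ae P, forall w, forall m, ~ lim_sup_set (F m) w}.
  apply: ae_foralln => m; exists (lim_sup_set (F m)); split.
  - apply: bigcap_measurable => // k _; exact: bigcup_measurable.
  - exact: PL0.
  - by move=> w /=; exact: contrapT.
apply: filterS => w Hw; apply/cvgr0Pnorm_lt => e e0.
pose m := Num.truncn e^-1.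
have me : m.+1%:R^-1 < e.
  by rewrite invf_plt ?posrE// truncnS_gt.
have := Hw m; rewrite /lim_sup_set => /existsNP[N /not_implyP[_ HN]].
(* Starting at [N.+1] keeps [n] positive, so that the division by n^b is legitimate. *)
exists N.+1 => // n /= Nn.
have n0 : (0 < n)%N by exact: leq_trans Nn.
have pn : 0 < n%:R `^ b :> R by rewrite powR_gt0 ?ltr0n.
apply: le_lt_trans me.
rewrite normrM normfV (gtr0_norm pn) ler_pdivrMr//.
rewrite leNgt; apply/negP => /ltW H; apply: HN.
by exists n => //=; exact: ltnW.
Qed.

End AlmostSureRate.

(** * Fluctuations of the environment *)

(** Both sides are integrals of [f] against the common law on [V]. *)
Lemma integral_identically_distributed (d d' : measure_display)
    (T : measurableType d) (V : measurableType d') (R : realType)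
    (P : probability T R) (I : choiceType) (D : set I) (X : I -> T -> V)
    (f : V -> \bar R) (i j : I) :
  (forall k, measurable_fun setT (X k)) ->
  identically_distributed P D X -> D i -> D j ->
  measurable_fun setT f ->
  P.-integrable setT (f \o X i) -> P.-integrable setT (f \o X j) ->
  (\int[P]_w f (X i w) = \int[P]_w f (X j w))%E.
Proof.
move=> mX idX Di Dj mf fi fj.
pose Xm k : {mfun T >-> V} :=
  HB.pack (X k) (isMeasurableFun.Build _ _ _ _ _ (mX k)).
rewrite -(@integral_distribution _ _ _ _ _ P (Xm i) f mf fi).
rewrite -(@integral_distribution _ _ _ _ _ P (Xm j) f mf fj).
by apply: eq_measure_integral => A mA _; exact: idX.
Qed.

Section ClampedLogOdds.
Context {R : realType} (delta : R).
Hypotheses (delta_gt0 : 0 < delta) (delta_lt : delta < 1 / 2).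
Implicit Types v : R * R.

(* The fluctuations are handled through everywhere bounded versions of zeta
   and Z, which agree with them almost surely. *)
Definition clamp_xi v := truncate delta (1 - delta) v.1.
Definition clamp_zeta v := logit (clamp_xi v).
Definition clamp_Z v := truncate (-1) 1 v.2 / (clamp_xi v * (1 - clamp_xi v)).

Let clamp_xi_bounds v : delta <= clamp_xi v <= 1 - delta.
Proof. by apply: truncate_bounds; move: delta_gt0 delta_lt; lra. Qed.

Lemma measurable_clamp_xi : measurable_fun setT clamp_xi.
Proof. by apply: measurable_truncate; exact: measurable_fst. Qed.

Lemma measurable_clamp_zeta : measurable_fun setT clamp_zeta.
Proof. by apply: measurable_logit; exact: measurable_clamp_xi. Qed.

Lemma measurable_clamp_Z : measurable_fun setT clamp_Z.
Proof.
apply: measurable_fun_div.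
  by apply: measurable_truncate; exact: measurable_snd.
apply: measurable_funM; first exact: measurable_clamp_xi.
by apply: measurable_funB => //; exact: measurable_clamp_xi.
Qed.

Lemma clamp_zeta_bounded v : `|clamp_zeta v| <= - 2 * ln delta.
Proof.
have /andP[x1 x2] := clamp_xi_bounds v; rewrite /clamp_zeta /logit.
move: (clamp_xi v) x1 x2 => x x1 x2.
have d0 := delta_gt0; have dl := delta_lt.
have xp : 0 < x by lra.
have xq : 0 < 1 - x by lra.
rewrite ln_div ?posrE//.
have a1 : ln delta <= ln x by rewrite ler_ln ?posrE.
have a2 : ln delta <= ln (1 - x) by rewrite ler_ln ?posrE//; lra.
have b1 : ln x <= 0 by apply: ln_le0; lra.
have b2 : ln (1 - x) <= 0 by apply: ln_le0; lra.
rewrite ler_norml; apply/andP; split; lra.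
Qed.

Lemma clamp_Z_bounded v : `|clamp_Z v| <= (delta ^+ 2)^-1.
Proof.
have /andP[x1 x2] := clamp_xi_bounds v.
have d0 := delta_gt0; have dl := delta_lt.
have dd : delta ^+ 2 <= clamp_xi v * (1 - clamp_xi v) by rewrite expr2; nra.
have dd0 : 0 < delta ^+ 2 by rewrite exprn_gt0.
have xx := lt_le_trans dd0 dd.
rewrite /clamp_Z normrM normfV (gtr0_norm xx) -[leRHS]mul1r ler_pM//.
- by rewrite invr_ge0 ltW.
- by rewrite ler_norml; apply: truncate_bounds; lra.
- by rewrite lef_pV2 ?posrE.
Qed.

End ClampedLogOdds.

(** * Almost sure asymptotics of the stationary distribution *)

Theorem theorem6 (R : realType) (d : measure_display) (T : measurableType d)
    (P : probability T R) (delta alpha : R) (xi Y : nat -> {RV P >-> R})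
    (delta_gt0 : 0 < delta) (delta_lt : delta < 1 / 2)
    (xiY_iid : iid P [set i | (1 <= i)%N] (fun i w => (xi i w, Y i w)))
    (xi_bounds : P [set w | delta <= xi 1%N w <= 1 - delta] = 1%E)
    (Y_bounds : P [set w | -1 <= Y 1%N w <= 1] = 1%E)
    (zeta_centered : ('E_P[zeta xi 1] = 0)%E)
    (s2_bounds : (0 < 'V_P[xi 1%N] < +oo)%E)
    (lambda_gt0 : (0 < 'E_P[Zvar xi Y 1])%E)
    (sigma2_bounds : (0 <= 'V_P[Y 1%N] < +oo)%E)
    (alpha_gt0 : 0 < alpha) (alpha_lt : alpha < 1 / 2) :
  let lambda := fine ('E_P[Zvar xi Y 1])%E in
  {ae P, forall w, exists mu : nat -> R,
    let K := walk_trans (environment delta alpha xi Y w) in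
    [/\ stationary_distribution K mu,
        forall nu, stationary_distribution K nu -> nu = mu
      & exists2 eps : nat -> R, eps @ \oo --> (0 : R) &
          \forall n \near \oo,
            mu n = expR (- (lambda / (1 - alpha)) *
                           n%:R `^ (1 - alpha) * (1 + eps n))]}.
Proof.
move=> lambda; have [indV idV] := xiY_iid.
pose V k w := (xi k w, Y k w).
have mV k : measurable_fun setT (V k) by exact: measurable_fun_pair.
pose A := [set v : R * R | delta <= v.1 <= 1 - delta].
pose B := [set v : R * R | -1 <= v.2 <= 1].
have mA : measurable A.
  have -> : A = fst @^-1` `[delta, 1 - delta]%classic.
    by apply/seteqP; split => v; rewrite /A /= in_itv.
  by rewrite -[X in measurable X]setTI; apply: measurable_fst.
have mB : measurable B.
  have -> : B = snd @^-1` `[-1, 1]%classic.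
    by apply/seteqP; split => v; rewrite /B /= in_itv.
  by rewrite -[X in measurable X]setTI; apply: measurable_snd.
(* The bounds at index 1 pass to each [k >= 1] by equality of laws, and then to all [k] at once by
   countability. *)
have good : {ae P, forall w, forall k, (1 <= k)%N -> A (V k w) /\ B (V k w)}.
  apply: ae_foralln => k; have [->|k1] := posnP k; first exact: aeW.
  have PA : P (V k @^-1` A) = 1%E.
    by have E := idV k 1%N k1 (leqnn 1) _ mA; rewrite [LHS]E.
  have PB : P (V k @^-1` B) = 1%E.
    by have E := idV k 1%N k1 (leqnn 1) _ mB; rewrite [LHS]E.
  have mVA : measurable (V k @^-1` A).
    by rewrite -[X in measurable X]setTI; exact: mV.
  have mVB : measurable (V k @^-1` B).
    by rewrite -[X in measurable X]setTI; exact: mV.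
  have aeA := ae_of_probability1 P _ mVA PA.
  have aeB := ae_of_probability1 P _ mVB PB.
  by apply: filterS2 aeA aeB => w wA wB _; split.
have clampE w k : A (V k w) -> clamp_zeta delta (V k w) = zeta xi k w.
  by move=> wA; rewrite /clamp_zeta /clamp_xi truncate_id.
have clampZE w k : A (V k w) -> B (V k w) -> clamp_Z delta (V k w) = Zvar xi Y k w.
  by move=> wA wB; rewrite /clamp_Z /clamp_xi !truncate_id.
have mz := measurable_clamp_zeta delta.
have mZ := measurable_clamp_Z delta.
have mzV k : measurable_fun setT (fun w => clamp_zeta delta (V k w)).
  exact: (measurableT_comp mz).
have mZV k : measurable_fun setT (fun w => clamp_Z delta (V k w)).
  exact: (measurableT_comp mZ).
have iz k : P.-integrable setT (EFin \o (fun w => clamp_zeta delta (V k w))).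
  by apply: integrable_bounded => // w; exact: clamp_zeta_bounded.
have iZ k : P.-integrable setT (EFin \o (fun w => clamp_Z delta (V k w))).
  by apply: integrable_bounded => // w; exact: clamp_Z_bounded.
have Ez k : (1 <= k)%N -> (\int[P]_w (clamp_zeta delta (V k w))%:E = 0)%E.
  move=> k1.
  have mf : measurable_fun setT (EFin \o clamp_zeta delta) by exact/measurable_EFinP.
  rewrite [LHS](@integral_identically_distributed _ _ _ _ _ P _ _ V _ _ 1%N mV idV k1
    (leqnn 1) mf (iz k) (iz 1%N)).
  rewrite -zeta_centered unlock; apply: ae_eq_integral => //.
  - exact/measurable_EFinP.
  - by apply/measurable_EFinP; exact: measurable_logit.
  - by apply: filterS good => w /(_ 1%N isT)[wA _] _ /=; rewrite clampE.
have EZ1 : ('E_P[Zvar xi Y 1] = \int[P]_w (clamp_Z delta (V 1%N w))%:E)%E.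
  rewrite unlock; apply: ae_eq_integral => //.
  - apply/measurable_EFinP; apply: measurable_fun_div => //.
    by apply: measurable_funM => //; exact: measurable_funB.
  - exact/measurable_EFinP.
  - by apply: filterS good => w /(_ 1%N isT)[wA wB] _ /=; rewrite clampZE.
have EZ k : (1 <= k)%N -> (\int[P]_w (clamp_Z delta (V k w))%:E = lambda%:E)%E.
  move=> k1.
  have mf : measurable_fun setT (EFin \o clamp_Z delta) by exact/measurable_EFinP.
  rewrite [LHS](@integral_identically_distributed _ _ _ _ _ P _ _ V _ _ 1%N mV idV k1
    (leqnn 1) mf (iZ k) (iZ 1%N)).
  rewrite -[LHS]EZ1 /lambda fineK// EZ1.
  by apply: integrable_fin_num => //; exact: (iZ 1%N).
have lambda0 : 0 < lambda.
  have := lambda_gt0; rewrite EZ1.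
  have -> : (\int[P]_w (clamp_Z delta (V 1%N w))%:E = lambda%:E)%E by exact: EZ.
  by rewrite lte_fin.
(* [g k (V k w)] is an everywhere bounded version of the centered fluctuation at site [k]. *)
pose g (k : nat) v :=
  clamp_zeta delta v + (clamp_Z delta v - lambda) * k%:R `^ (- alpha).
have mg k : measurable_fun setT (g k).
  apply: measurable_funD => //; apply: measurable_funM => //; exact: measurable_funB.
pose C := - 2 * ln delta + ((delta ^+ 2)^-1 + lambda).
have lnd : ln delta <= 0 by apply: ln_le0; lra.
have dV0 : 0 < (delta ^+ 2)^-1 by rewrite invr_gt0 exprn_gt0.
have C0 : 0 < C by rewrite /C; lra.
have gC k v : `|g k v| <= C.
  apply: (le_trans (ler_normD _ _)); apply: lerD; first exact: clamp_zeta_bounded.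
  rewrite normrM -[leRHS]mulr1; apply: ler_pM => //.
    apply: (le_trans (ler_normB _ _)); rewrite (gtr0_norm lambda0) lerD2r.
    exact: clamp_Z_bounded.
  (* At [k = 0] the power with nonzero exponent is 0 by convention, so the bound persists. *)
  rewrite ger0_norm ?powR_ge0//; case: k => [|k].
    by rewrite powR0// oppr_eq0 gt_eqF.
  by rewrite powRN invf_le1 ?powR_gt0//
    -[leLHS](powRr0 k.+1%:R) ler_powR ?ler1n// ltW.
have gE0 k : (1 <= k)%N -> (\int[P]_w (g k (V k w))%:E = 0)%E.
  move=> k1; pose q := k%:R `^ (- alpha) : R.
  have il : P.-integrable setT (cst lambda%:E) by exact: finite_measure_integrable_cst.
  have iZl : P.-integrable setT
      ((EFin \o (fun w => clamp_Z delta (V k w))) \- cst lambda%:E)%E.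
    exact: integrableB.
  transitivity (\int[P]_w ((clamp_zeta delta (V k w))%:E +
      q%:E * ((clamp_Z delta (V k w))%:E - lambda%:E)))%E.
    by apply: eq_integral => w _; rewrite /g EFinD mulrC EFinM EFinB.
  rewrite integralD//; [|exact: iz|exact: integrableZl].
  rewrite Ez// add0e integralZl// integralB//; last exact: iZ.
  rewrite EZ// integral_cst//.
  by rewrite (_ : _ setT = 1%E) ?mule1 ?subee ?mule0//; exact: probability_setT.
have rate : {ae P, forall w,
    (fun n => (\sum_(1 <= k < n.+1) g k (V k w)) / n%:R `^ (1 - alpha)) @ \oo
      --> (0 : R)}.
  apply: (@ae_sum_littleo_powR _ _ _ P (fun k w => g k (V k w)) C) => //.
  - by move=> k; exact: (measurableT_comp (mg k)).
  - move=> t n.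
    under eq_integral do rewrite mulr_sumr expR_sum -prodEFin.
    apply: (@integral_prod_independent _ _ _ _ _ _ P [set i | (1 <= i)%N] V mV indV
      (fun k v => (expR (t * g k v))%:E)).
    + move=> k; apply/measurable_EFinP; apply: measurableT_comp => //.
      exact: measurable_funM.
    + by move=> k v; rewrite lee_fin expR_ge0.
    + exact: iota_uniq.
    + by move=> k /=; rewrite mem_index_iota => /andP[].
  (* Here [alpha < 1 / 2] enters as [1 - alpha > 1 / 2], the exponent required for the almost sure
     rate. *)
  - lra.
apply: filterS2 good rate => w wgood wrate.
apply: (@stationary_asymptotics _ (environment delta alpha xi Y w) _ (delta / 2)).
- move=> n; rewrite /environment; case: eqP => _; first lra.
  have := @truncate_bounds R (delta / 2) (1 - delta / 2)
    (xi n w + Y n w * n%:R `^ (- alpha)) ltac:(lra); lra.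
- lra.
- by rewrite divr_gt0//; lra.
- by rewrite divr_gt0.
- move=> n; rewrite /environment; case: eqP => _; first lra.
  have := @truncate_bounds R (delta / 2) (1 - delta / 2)
    (xi n w + Y n w * n%:R `^ (- alpha)) ltac:(lra); lra.
apply: (@cvg_sum_logit _ delta alpha lambda (fun k => xi k w) (fun k => Y k w)) => //.
- by move=> k /wgood[].
- by move=> k /wgood[].
- by move=> k k1; rewrite /environment gtn_eqF.
(* On the good event clamping is the identity, so the bounded fluctuations are the actual ones. *)
- apply: cvg_trans wrate; apply: near_eq_cvg; apply: nearW => n.
  rewrite !big_nat; congr (_ / _); apply: eq_bigr => k /andP[k1 _].
  by have [wA wB] := wgood k k1; rewrite /g clampE// clampZE.
Qed.
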